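(* Consider a nonholonomic system with affine constraints $(L,G,\mathcal{M})$, where $G$ is a Lie group. Assume that the Lagrangian $L$ is left-invariant and that the affine distribution $\mathcal{M}$ can be written as $\mathcal{M}=Z+\mathcal{D}$ with a right-invariant vector field $Z$. Then the (horizontal) moving energy $$E_{L,Z}|_M=\big(E_L-\langle p,Z\rangle\big)\big|_M$$ is a first integral of $(L,G,\mathcal{M})$.
   Context: All objects are smooth. The configuration manifold is a Lie group $G$ of dimension $n$. The Lagrangian $L:TG\to\mathbb{R}$ has the form $L=T+b-V\circ\pi$, with $T$ the kinetic energy of a Riemannian metric on $G$, $b$ a 1-form on $G$ regarded as a function on $TG$, $V$ a function on $G$, and $\pi:TG\to G$ the projection. $L$ is left-invariant if it is invariant under the tangent lift to $TG$ of every left translation of $G$. A vector field $Z$ on $G$ is right-invariant if $(\mathrm{R}_g)_*Z=Z$ for all $g\in G$, with $\mathrm{R}_g$ right translation. $\mathcal{D}$ is a nonintegrable distribution on $G$ of constant rank $r$, $1<r<n$. The affine constraint distribution $\mathcal{M}=Z+\mathcal{D}$ has fibers $\mathcal{M}_g=Z(g)+\mathcal{D}_g\subset T_gG$; the submanifold $M\subset TG$ with these fibers is the constraint manifold. The constraint is ideal (d'Alembert): in local coordinates $(q,\dot q)$ of $TG$ the equations of motion are the restriction to $M$ of $\frac{d}{dt}\frac{\partial L}{\partial\dot q}-\frac{\partial L}{\partial q}=R$, where $R:M\to\mathcal{D}^\circ$ (fiberwise, with values in the annihilator of $\mathcal{D}$) is the unique such function (the reaction force) for which these equations define a dynamics on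 $M$. A first integral is a function on $M$ constant along all solutions of the equations of motion. $p$ is the momentum 1-form generated by $L$ (in coordinates $p=\partial L/\partial\dot q$), $E_L:=\langle p,\cdot\rangle-L$, and for a vector field $Y$ on $G$, $E_{L,Y}:=E_L-\langle p,Y\rangle$, as functions on $TG$. A moving energy is a function on $M$ of the form $E_{L,Y}|_M$; such a $Y$ is called a generator. It is horizontal if it has a generator $Y$ such that $Y-Z$ is a section of $\mathcal{D}$. *)

(* Defs.v *)
From HB Require Import structures.
From mathcomp Require Import all_boot all_order all_algebra.
From mathcomp Require Import all_classical all_reals all_analysis.
Import Order.TTheory GRing.Theory Num.Theory numFieldNormedType.Exports.

Set Implicit Arguments.
Unset Strict Implicit.
Unset Printing Implicit Defensive.

Local Open Scope classical_set_scope.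
Local Open Scope ring_scope.

(* A group carrying a topology; compatibility of the two is a field of
   [lie_group] below. *)
#[short(type="groupTopType")]
HB.structure Definition GroupTop := {G of Group G & Topological G}.

Section SmoothOn.
Variables (R : realType) (V W : normedModType R).

(* Meant for [U] open and [V] finite-dimensional: asking that the derivative
   be C^k against every fixed vector is then the usual C^(k+1). *)
Fixpoint Ck_on (k : nat) (U : set V) (f : V -> W) : Prop :=
  if k is k'.+1 then
    (forall x, U x -> differentiable f x) /\
    (forall v, Ck_on k' U (fun x => 'd f x v))
  else forall x, U x -> {for x, continuous f}.

Definition smooth_on (U : set V) (f : V -> W) := forall k, Ck_on k U f.

End SmoothOn.

Section Manifold.
Variables (R : realType) (n : nat).

(* The values of [chart_coord] outside [chart_dom], and of [chart_param] outside
   [chart_im], are irrelevant. *)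
Record chart (G : topologicalType) := Chart {
  chart_dom : set G;
  chart_coord : G -> 'rV[R]_n;
  chart_param : 'rV[R]_n -> G;
  chart_open_dom : open chart_dom;
  chart_open_im : open (chart_coord @` chart_dom);
  chart_coordK : forall g, chart_dom g -> chart_param (chart_coord g) = g;
  chart_coord_cont : forall g, chart_dom g -> {for g, continuous chart_coord};
  chart_param_cont :
    forall x, (chart_coord @` chart_dom) x -> {for x, continuous chart_param} }.

Definition chart_im (G : topologicalType) (c : chart G) : set 'rV[R]_n :=
  chart_coord c @` chart_dom c.

(* [chart_at g] is a preferred chart at [g].  The tangent space at [g] is
   encoded as 'rV[R]_n by taking components in that chart, so that TG becomes
   the (non-topological) product G * 'rV[R]_n.  Every notion below is moved to
   arbitrary charts of the atlas by [tcoord] and [tvec]. *)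
Record lie_group (G : groupTopType) := LieGroup {
  atlas : set (chart G);
  chart_at : G -> chart G;
  lie_chart_at_atlas : forall g, atlas (chart_at g);
  lie_chart_at_dom : forall g, chart_dom (chart_at g) g;
  lie_transition : forall c d, atlas c -> atlas d ->
    smooth_on (chart_coord c @` (chart_dom c `&` chart_dom d))
      (chart_coord d \o chart_param c);
  lie_hausdorff : hausdorff_space G;
  lie_second_countable : @second_countable G;
  lie_mul_cont : continuous (fun p : G * G => (p.1 * p.2)%g);
  lie_inv_cont : continuous (fun g : G => (g^-1)%g);
  lie_mul_smooth : forall c d e, atlas c -> atlas d -> atlas e ->
    smooth_on
      [set x : 'rV[R]_n * 'rV[R]_n |
        [/\ chart_im c x.1, chart_im d x.2
          & chart_dom e (chart_param c x.1 * chart_param d x.2)%g]]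
      (fun x => chart_coord e (chart_param c x.1 * chart_param d x.2)%g);
  lie_inv_smooth : forall c d, atlas c -> atlas d ->
    smooth_on
      [set x | chart_im c x /\ chart_dom d ((chart_param c x)^-1)%g]
      (fun x => chart_coord d ((chart_param c x)^-1)%g) }.

Variables (G : groupTopType) (S : lie_group G).

(* Components in [c] of the tangent vector [v] at [g]. *)
Definition tcoord (c : chart G) (g : G) (v : 'rV[R]_n) : 'rV[R]_n :=
  'd (chart_coord c \o chart_param (chart_at S g))
     (chart_coord (chart_at S g) g) v.

(* The tangent vector at [chart_param c x] whose components in [c] are [v]. *)
Definition tvec (c : chart G) (x v : 'rV[R]_n) : 'rV[R]_n :=
  'd (chart_coord (chart_at S (chart_param c x)) \o chart_param c) x v.

Definition tmap (f : G -> G) (g : G) (v : 'rV[R]_n) : 'rV[R]_n :=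
  'd (chart_coord (chart_at S (f g)) \o f \o chart_param (chart_at S g))
     (chart_coord (chart_at S g) g) v.

Definition velocity (q : R -> G) (t : R) : 'rV[R]_n :=
  derive1 (chart_coord (chart_at S (q t)) \o q) t.

Definition pairing (p : 'cV[R]_n) (v : 'rV[R]_n) : R := (v *m p) 0 0.

Definition metric_form (a : 'M[R]_n) (u v : 'rV[R]_n) : R :=
  (u *m a *m v^T) 0 0.

Definition smooth_function (V : G -> R) :=
  forall c, atlas S c -> smooth_on (chart_im c) (V \o chart_param c).

Definition smooth_vector_field_on (U : set G) (X : G -> 'rV[R]_n) :=
  forall c, atlas S c ->
    smooth_on (chart_coord c @` (chart_dom c `&` U))
      (fun x => tcoord c (chart_param c x) (X (chart_param c x))).

Definition smooth_vector_field (X : G -> 'rV[R]_n) :=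
  smooth_vector_field_on setT X.

Definition smooth_one_form (b : G -> 'cV[R]_n) :=
  forall c, atlas S c -> forall u : 'rV[R]_n,
    smooth_on (chart_im c)
      (fun x => pairing (b (chart_param c x)) (tvec c x u)).

Definition riemannian_metric (a : G -> 'M[R]_n) :=
  [/\ forall g, (a g)^T = a g,
      forall g v, v != 0 -> 0 < metric_form (a g) v v
    & forall c, atlas S c -> forall u w : 'rV[R]_n,
        smooth_on (chart_im c)
          (fun x => metric_form (a (chart_param c x))
                      (tvec c x u) (tvec c x w))].

Definition smooth_curve_on (I : set R) (q : R -> G) :=
  (forall t, I t -> {for t, continuous q}) /\
  (forall c, atlas S c ->
     smooth_on (I `&` q @^-1` chart_dom c) (chart_coord c \o q)).

Definition natural_lagrangian (L : G -> 'rV[R]_n -> R) :=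
  exists a b V,
    [/\ riemannian_metric a, smooth_one_form b, smooth_function V
      & forall g v,
          L g v = 2^-1 * metric_form (a g) v v + pairing (b g) v - V g].

Definition left_invariant_lagrangian (L : G -> 'rV[R]_n -> R) :=
  forall h g v, L (h * g)%g (tmap (fun x => h * x)%g g v) = L g v.

Definition right_invariant_field (Z : G -> 'rV[R]_n) :=
  forall h g, tmap (fun x => x * h)%g g (Z g) = Z (g * h)%g.

Definition smooth_distribution (r : nat) (D : G -> {vspace 'rV[R]_n}) :=
  (forall g, \dim (D g) = r) /\
  (forall g0, exists U (X : 'I_r -> G -> 'rV[R]_n),
     [/\ open U, U g0, forall i, smooth_vector_field_on U (X i)
       & forall g, U g -> D g = (\sum_(i < r) <[X i g]>)%VS]).

(* Through every point passes an integral manifold, given by a local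
   parametrization [f]; [f] is an immersion because the image of its
   differential at [w] is the [r]-dimensional space [D (f w)]. *)
Definition integrable_distribution (r : nat) (D : G -> {vspace 'rV[R]_n}) :=
  forall g, exists (A : set 'rV[R]_r) (f : 'rV[R]_r -> G),
    [/\ open A /\ A 0, f 0 = g,
        forall w, A w -> {for w, continuous f},
        forall c, atlas S c ->
          smooth_on (A `&` f @^-1` chart_dom c) (chart_coord c \o f)
      & forall w, A w -> forall v, v \in D (f w) <->
          exists u, v = 'd (chart_coord (chart_at S (f w)) \o f) w u].

Definition affine_distribution (Z : G -> 'rV[R]_n)
    (D : G -> {vspace 'rV[R]_n}) : G -> set 'rV[R]_n :=
  fun g => [set Z g + w | w in [set w | w \in D g]].

Definition local_lagrangian (c : chart G) (L : G -> 'rV[R]_n -> R)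
    (x v : 'rV[R]_n) : R :=
  L (chart_param c x) (tvec c x v).

Definition basis_vec (i : 'I_n) : 'rV[R]_n := delta_mx 0 i.

(* [i]-th component at time [t] of
   d/dt (dL/d\dot q) - dL/dq along [q], in the chart [c]. *)
Definition euler_lagrange (c : chart G) (L : G -> 'rV[R]_n -> R)
    (q : R -> G) (t : R) (i : 'I_n) : R :=
  let x := chart_coord c \o q in
  derive1 (fun s => 'D_(basis_vec i) (local_lagrangian c L (x s))
                      (derive1 x s)) t
  - 'D_(basis_vec i) (fun y => local_lagrangian c L y (derive1 x t)) (x t).

Definition solution (L : G -> 'rV[R]_n -> R) (M : G -> set 'rV[R]_n)
    (F : G -> 'rV[R]_n -> 'cV[R]_n) (I : set R) (q : R -> G) :=
  [/\ open I /\ is_interval I,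
      smooth_curve_on I q,
      forall t, I t -> M (q t) (velocity q t)
    & forall t, I t -> forall c, atlas S c -> chart_dom c (q t) -> forall i,
        euler_lagrange c L q t i =
        pairing (F (q t) (velocity q t))
          (tvec c (chart_coord c (q t)) (basis_vec i))].

(* Smoothness of [F] on the subset [M] of TG: local existence, in the charts
   of TG induced by those of G, of smooth extensions. *)
Definition smooth_force (M : G -> set 'rV[R]_n)
    (F : G -> 'rV[R]_n -> 'cV[R]_n) :=
  forall c, atlas S c -> forall x v, chart_im c x ->
    M (chart_param c x) (tvec c x v) ->
    forall i, exists (A : set ('rV[R]_n * 'rV[R]_n)) f,
      [/\ open A, A (x, v), smooth_on A f
        & forall y w, A (y, w) -> chart_im c y ->
            M (chart_param c y) (tvec c y w) ->
            f (y, w) = pairing (F (chart_param c y) (tvec c y w))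
                         (tvec c y (basis_vec i))].

(* Only the values of [F] on [M] matter.  The last clause says that the
   equations of motion define a dynamics on [M]: a solution that stays in [M]
   starts from every point of [M].  As the kinetic metric is definite, it
   determines [F] uniquely on [M]. *)
Definition reaction_force (L : G -> 'rV[R]_n -> R)
    (D : G -> {vspace 'rV[R]_n}) (M : G -> set 'rV[R]_n)
    (F : G -> 'rV[R]_n -> 'cV[R]_n) :=
  [/\ forall g v, M g v -> forall w, w \in D g -> pairing (F g v) w = 0,
      smooth_force M F
    & forall g v, M g v -> exists I q,
        [/\ solution L M F I q, I 0, q 0 = g & velocity q 0 = v]].

(* <p, w> at the point (g, v) of TG, for p the fibre derivative of [L]. *)
Definition momentum (L : G -> 'rV[R]_n -> R) (g : G) (v w : 'rV[R]_n) : R :=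
  'D_w (L g) v.

Definition energy (L : G -> 'rV[R]_n -> R) (g : G) (v : 'rV[R]_n) : R :=
  momentum L g v v - L g v.

Definition moving_energy (L : G -> 'rV[R]_n -> R) (Y : G -> 'rV[R]_n)
    (g : G) (v : 'rV[R]_n) : R :=
  energy L g v - momentum L g v (Y g).

Definition horizontal_moving_energy (L : G -> 'rV[R]_n -> R)
    (Z : G -> 'rV[R]_n) (D : G -> {vspace 'rV[R]_n})
    (M : G -> set 'rV[R]_n) (f : G -> 'rV[R]_n -> R) :=
  exists Y,
    [/\ smooth_vector_field Y,
        forall g v, M g v -> f g v = moving_energy L Y g v
      & forall g, Y g - Z g \in D g].

(* Functions on [M] are functions on TG of which only the values on [M]
   are used. *)
Definition first_integral (L : G -> 'rV[R]_n -> R) (M : G -> set 'rV[R]_n)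
    (F : G -> 'rV[R]_n -> 'cV[R]_n) (f : G -> 'rV[R]_n -> R) :=
  forall I q, solution L M F I q ->
    forall s t, I s -> I t ->
      f (q s) (velocity q s) = f (q t) (velocity q t).

End Manifold.

(* Main.v *)
Require Import Defs.
From mathcomp Require Import all_boot all_order all_algebra.
From mathcomp Require Import all_classical all_reals all_analysis.
From mathcomp Require Import ring lra.
Import Order.TTheory GRing.Theory Num.Theory numFieldNormedType.Exports.
Local Open Scope classical_set_scope.
Local Open Scope ring_scope.

(** Fix a solution [q] and a chart [c] around [q t].  Write [x] for the curve
in coordinates, [l x v] for the Lagrangian and [zeta] for [Z] there, and [w]
for [x' - zeta x].  The moving energy along the curve is
  sum_i w_i * (dl/dv_i) - l,
because the momentum is linear in its last argument.  Its time derivative is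
  sum_i w_i * (d/dt dl/dv_i - dl/dx_i) - dl (zeta, dzeta x'),
where [dl] is the differential of [l] at [(x, x')]: the terms with the
acceleration cancel ([is_derive_moving_energy]).  Both parts vanish.

The first is the work of the reaction force on [w].  The curve satisfies the
constraint, so [w] represents a vector of [D], which the force annihilates.

The second is the derivative of [L] along the tangent lift of the flow of [Z].
A right-invariant field generates left translations, which preserve [L].
The flow itself can be avoided.  If [mu (y, x)] is the multiplication in
charts, left invariance says that
  l (mu (y, x)) (d_x mu (y, x) v) = l x v   for [y] near the unit,
and right invariance says that [zeta x] is the derivative of [mu] in its first
argument at the unit, in the direction [Z 1].  Differentiating the first
identity in [y] in that direction gives [dl (zeta, dzeta v) = 0], once the two
orders of differentiation of [mu] are exchanged ([infinitesimal_invariance]).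
This exchange is the symmetry of second derivatives ([diff_diff_sym]).

So the moving energy has zero derivative at every time of the interval on which
the solution is defined, hence is constant.  It is horizontal because the
generator [Z] differs from [Z] by the zero section of [D]. *)

Set Implicit Arguments.
Unset Strict Implicit.
Unset Printing Implicit Defensive.

(** * Differential calculus *)

Lemma is_derive_line (R : realType) (V W : normedModType R) (f : V -> W) (z a : V) (s : R) :
  derivable f (z + s *: a) a ->
  is_derive s 1 (fun t => f (z + t *: a)) ('D_a f (z + s *: a)).
Proof.
have E : (fun h : R => h^-1 *: (((fun t => f (z + t *: a)) \o shift s) (h *: (1 : R))
             - f (z + s *: a)))
       = (fun h : R => h^-1 *: ((f \o shift (z + s *: a)) (h *: a) - f (z + s *: a))).
  apply/funext => h /=; congr (_ *: (f _ - _)).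
  by rewrite [h *: 1]mulr1 scalerDl addrCA.
by move=> fa; split; rewrite ?/derivable ?/derive E.
Qed.

(** Applying the mean value theorem in the direction [a] and then in the
    direction [b] turns the second difference of [f], which is symmetric in
    [a] and [b], into an iterated derivative at an unspecified nearby point. *)
Lemma second_difference (R : realType) (V : normedModType R) (f : V -> R)
    (z a b : V) (s : R) : 0 < s ->
  (forall t u, 0 <= t <= s -> 0 <= u <= s -> derivable f (z + t *: a + u *: b) a) ->
  (forall t u, 0 <= t <= s -> 0 <= u <= s ->
     derivable ('D_a f) (z + t *: a + u *: b) b) ->
  exists t u, [/\ 0 <= t <= s, 0 <= u <= s &
    f (z + s *: a + s *: b) - f (z + s *: a) - (f (z + s *: b) - f z)
    = 'D_b ('D_a f) (z + t *: a + u *: b) * s * s].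
Proof.
move=> s0 fa fab.
pose phi t := f (z + s *: b + t *: a) - f (z + t *: a).
have dphi t : 0 <= t <= s ->
    is_derive t 1 phi ('D_a f (z + s *: b + t *: a) - 'D_a f (z + t *: a)).
  move=> t0s; apply: is_deriveB; apply: is_derive_line.
    by rewrite addrAC; apply: fa => //; rewrite lexx (ltW s0).
  by have := @fa t 0 t0s; rewrite scale0r addr0; apply; rewrite lexx (ltW s0).
have itvI t : t \in `]0, s[%R -> 0 <= t <= s.
  by rewrite in_itv /= => /andP[/ltW-> /ltW->].
have [t tI ht] : exists2 t, t \in `]0, s[%R & phi s - phi 0 =
    ('D_a f (z + s *: b + t *: a) - 'D_a f (z + t *: a)) * (s - 0).
  apply: (MVT s0) => [t /itvI|]; first exact: dphi.
  apply: derivable_within_continuous => t; rewrite in_itv /= => /dphi dt.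
  exact: ex_derive.
have t0s := itvI _ tI.
pose psi u := 'D_a f (z + t *: a + u *: b).
have dpsi u : 0 <= u <= s ->
    is_derive u 1 psi ('D_b ('D_a f) (z + t *: a + u *: b)).
  by move=> u0s; apply: is_derive_line; apply: fab.
have [u uI hu] : exists2 u, u \in `]0, s[%R & psi s - psi 0 =
    'D_b ('D_a f) (z + t *: a + u *: b) * (s - 0).
  apply: (MVT s0) => [u /itvI|]; first exact: dpsi.
  apply: derivable_within_continuous => u; rewrite in_itv /= => /dpsi du.
  exact: ex_derive.
exists t, u; split=> //; first exact: itvI.
move: ht hu; rewrite /phi /psi !scale0r !addr0 !subr0 => ht hu.
rewrite -hu [z + t *: a + s *: b]addrAC -ht [z + s *: a + s *: b]addrAC.
by rewrite !opprB !addrA; congr (_ + _); rewrite addrAC.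
Qed.

(** The two iterated derivatives agree at two nearby points, by
    [second_difference] used in both orders; continuity at [z] concludes. *)
Lemma derive_derive_sym (R : realType) (V : normedModType R) (f : V -> R) (z a b : V) :
  (\forall w \near z, [/\ derivable f w a, derivable f w b,
     derivable ('D_a f) w b & derivable ('D_b f) w a]) ->
  {for z, continuous ('D_b ('D_a f))} -> {for z, continuous ('D_a ('D_b f))} ->
  'D_b ('D_a f) z = 'D_a ('D_b f) z.
Proof.
have close (e x y p q : R) : `|x - p| < e / 2 -> `|y - q| < e / 2 -> p = q ->
    `|x - y| <= e.
  move=> xp yq pq; rewrite -pq in yq; rewrite (le_trans (ler_distD p _ _)) //.
  by rewrite [leRHS]splitr lerD // ltW // distrC.
move=> fz cab cba; apply/eqP; rewrite -subr_eq0 -normr_le0; apply/ler_addgt0Pr => e e0.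
rewrite add0r.
have e2 : 0 < e / 2 by rewrite divr_gt0.
have /cvgrPdist_lt/(_ _ e2) nab := cab.
have /cvgrPdist_lt/(_ _ e2) nba := cba.
have Fz := nbhs_filter z.
have nz := @filterI _ (nbhs z) Fz _ _ fz (@filterI _ (nbhs z) Fz _ _ nab nba).
have [d d0 dP] := (nbhs_ballP _ _).1 nz.
rewrite /= in d0.
(* With this step the parallelogram spanned by [s *: a] and [s *: b] stays in
   the ball of radius [d]. *)
pose s := d / (`|a| + `|b| + 1) / 2.
have ab0 : 0 < `|a| + `|b| + 1 by rewrite ltr_wpDl // addr_ge0.
have s0 : 0 < s by rewrite !divr_gt0.
have inb t u : 0 <= t <= s -> 0 <= u <= s -> ball z d (z + t *: a + u *: b).
  move=> /andP[t0 ts] /andP[u0 us]; rewrite -ball_normE /= opprD addrA opprD addrA subrr.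
  rewrite sub0r -opprD normrN (le_lt_trans (ler_normD _ _)) // !normrZ !ger0_norm //.
  have : t * `|a| <= s * `|a| by rewrite ler_wpM2r.
  have : u * `|b| <= s * `|b| by rewrite ler_wpM2r.
  have : s * (`|a| + `|b| + 1) = d / 2.
    by rewrite /s mulrAC divfK // gt_eqF.
  have : d / 2 < d by rewrite ltr_pdivrMr // ltr_pMr // ltr1n.
  lra.
have [t [u [t0 u0 E1]]] : exists t u, [/\ 0 <= t <= s, 0 <= u <= s &
    f (z + s *: a + s *: b) - f (z + s *: a) - (f (z + s *: b) - f z)
    = 'D_b ('D_a f) (z + t *: a + u *: b) * s * s].
  apply: second_difference => [//|t u ht hu|t u ht hu].
    by have /dP[[ha _ _ _] _] := inb _ _ ht hu; exact: ha.
  by have /dP[[_ _ hab _] _] := inb _ _ ht hu; exact: hab.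
have [u' [t' [u0' t0' E2]]] : exists t u, [/\ 0 <= t <= s, 0 <= u <= s &
    f (z + s *: b + s *: a) - f (z + s *: b) - (f (z + s *: a) - f z)
    = 'D_a ('D_b f) (z + t *: b + u *: a) * s * s].
  apply: second_difference => [//|u' t' hu ht|u' t' hu ht]; rewrite (addrAC z).
    by have /dP[[_ hb _ _] _] := inb _ _ ht hu; exact: hb.
  by have /dP[[_ _ _ hba] _] := inb _ _ ht hu; exact: hba.
have [_ [h1 _]] := dP _ (inb _ _ t0 u0).
have [_ [_ h2]] := dP _ (inb _ _ t0' u0').
have E : 'D_b ('D_a f) (z + t *: a + u *: b) = 'D_a ('D_b f) (z + t' *: a + u' *: b).
  have sI : injective (fun p : R => p * s * s).
    by move=> p q /(mulIf (lt0r_neq0 s0)) /(mulIf (lt0r_neq0 s0)).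
  apply: sI; rewrite /= -[LHS]E1 [z + t' *: a + _]addrAC -[RHS]E2 [z + s *: b + _]addrAC.
  by rewrite !opprB addrACA [RHS]addrACA; congr (_ + _); exact: addrC.
exact: close h1 h2 E.
Qed.

(** Differentiability of both maps is assumed so that ['d] can be replaced by
    directional derivatives, which are manifestly local. *)
Lemma diff_near_eq (R : realType) (V W : normedModType R) (f g : V -> W) (x v : V) :
  differentiable f x -> differentiable g x -> (\forall y \near x, f y = g y) ->
  'd f x v = 'd g x v.
Proof. by move=> df dg fg; rewrite -!deriveE //; apply: near_eq_derive. Qed.

Lemma derive_linear_comp (R : realType) (V W Y : normedModType R)
    (A : {linear V -> W}) (f : W -> Y) (v w : V) :
  'D_w (f \o A) v = 'D_(A w) f (A v).
Proof.
suff E : (fun h : R => h^-1 *: (((f \o A) \o shift v) (h *: w) - (f \o A) v)) =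
    (fun h : R => h^-1 *: ((f \o shift (A v)) (h *: A w) - f (A v))).
  by rewrite /derive E.
by apply/funext => h /=; congr (_ *: (f _ - _)); rewrite linearD linearZ.
Qed.

Lemma derive_coord (R : realType) (V : normedModType R) m n (F : V -> 'M[R]_(m, n))
    (z a : V) i j :
  differentiable F z -> 'D_a (fun w => F w i j) z = ('d F z a) i j.
Proof.
by move=> dF; rewrite -deriveE // derive_mx ?mxE //; apply: diff_derivable.
Qed.

Lemma differentiable_entry (R : realType) (V : normedModType R) m n
    (F : V -> 'M[R]_(m, n)) (z : V) i j :
  differentiable F z -> differentiable (fun w => F w i j) z.
Proof.
move=> dF; have dc := differentiable_coord (F z) i j.
exact: (differentiable_comp dF dc).
Qed.

Lemma near_eq_continuous (R : realType) (V : normedModType R) (f g : V -> R) (z : V) :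
  (\forall w \near z, f w = g w) -> {for z, continuous f} -> {for z, continuous g}.
Proof.
move=> fg cf; have : g @ z --> f z by apply: cvg_trans cf; apply: near_eq_cvg.
by rewrite (nbhs_singleton fg).
Qed.

(** Schwarz's theorem, entry by entry from the scalar case. *)
Lemma diff_diff_sym (R : realType) (V : normedModType R) n (U : set V)
    (F : V -> 'rV[R]_n) (z a b : V) :
  nbhs z U -> Ck_on 2 U F ->
  'd (fun w => 'd F w a) z b = 'd (fun w => 'd F w b) z a.
Proof.
move=> Uz [dF ddF].
have dFv v w : U w -> differentiable (fun x => 'd F x v) w.
  by have [h _] := ddF v; exact: h.
have Uzz := nbhs_interior Uz.
apply/rowP => i; have zU := nbhs_singleton Uz.
pose f w := F w 0 i.
have fv v w : U w -> 'D_v f w = ('d F w v) 0 i.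
  by move=> Uw; rewrite derive_coord //; apply: dF.
have nfv v w : U^° w -> \forall y \near w, ('d F y v) 0 i = 'D_v f y.
  by move=> Uw; near=> y; rewrite fv //; near: y.
have dfv v u w : U^° w -> derivable ('D_v f) w u.
  move=> Uw; apply: (near_eq_derivable (nfv v w Uw)).
  apply: diff_derivable; apply: differentiable_entry; apply: dFv.
  exact: interior_subset Uw.
have ddfv v u w : U^° w -> 'D_u ('D_v f) w = ('d (fun x => 'd F x v) w u) 0 i.
  move=> Uw; rewrite -(near_eq_derive _ (nfv v w Uw)) derive_coord //.
  by apply: dFv; exact: interior_subset Uw.
have cfv v u : {for z, continuous ('D_u ('D_v f))}.
  apply: (@near_eq_continuous _ _ (fun w => ('d (fun x => 'd F x v) w u) 0 i)).
    by near=> w; rewrite ddfv //; near: w.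
  have [_ /(_ u z zU) c] := ddF v.
  have cc := differentiable_continuous
    (differentiable_coord ('d (fun x => 'd F x v) z u) 0 i).
  exact: (continuous_comp c cc).
have zU' := nbhs_singleton Uzz.
have Dfv v : \forall w \near z, derivable f w v.
  near=> w; apply: diff_derivable; apply: differentiable_entry; apply: dF.
  by apply: interior_subset; near: w.
have Ddfv v u : \forall w \near z, derivable ('D_v f) w u.
  by near=> w; apply: dfv; near: w.
rewrite -(ddfv a b z zU') -(ddfv b a z zU'); apply: derive_derive_sym (cfv a b) (cfv b a).
have I A B : (\near z, A z) -> (\near z, B z) -> \near z, A z /\ B z.
  exact: filterI.
have := I _ _ (I _ _ (Dfv a) (Dfv b)) (I _ _ (Ddfv a b) (Ddfv b a)).
by apply: filterS => w [[? ?] [? ?]]; apply: And4.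
Unshelve. all: by end_near. Qed.

Lemma eq_of_derive0 (R : realType) (f : R -> R) (I : set R) (s t : R) :
  is_interval I -> (forall u, I u -> is_derive u 1 f 0) -> I s -> I t -> f s = f t.
Proof.
move=> itvI df.
wlog st : s t / s <= t => [H Is It|Is It].
  by have [/H->|/ltW/H->] := leP s t.
have Iu u : s <= u <= t -> I u by move=> sut; exact: itvI Is It _ sut.
have [u _] : exists2 u, u \in `[s, t]%R & f t - f s = 0 * (t - s).
  apply: (@MVT_segment _ f (cst 0)) => // [u|].
    by rewrite in_itv /= => /andP[/ltW su /ltW ut]; apply/df/Iu; rewrite su ut.
  apply: derivable_within_continuous => u; rewrite in_itv /= => /Iu Iu'.
  exact: (@ex_derive _ _ _ _ _ _ _ (df u Iu')).
by rewrite mul0r => /eqP; rewrite subr_eq0 => /eqP.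
Qed.

(** * The moving energy in coordinates *)

Lemma linear_row_sum (R : realType) n (A : {linear 'rV[R]_n -> R}) (u : 'rV[R]_n) :
  A u = \sum_i u 0 i * A (basis_vec R i).
Proof.
rewrite {1}(row_sum_delta u) linear_sum; apply: eq_bigr => i _.
exact: linearZ.
Qed.

Lemma differentiable_pair_cst (R : realType) (V W : normedModType R) (x : V) (y : W) :
  differentiable (fun x' => (x', y)) x.
Proof. by apply: differentiable_pair => //; exact: differentiable_cst. Qed.

Lemma differentiable_cst_pair (R : realType) (V W : normedModType R) (x : V) (y : W) :
  differentiable (fun y' => (x, y')) y.
Proof. by apply: differentiable_pair => //; exact: differentiable_cst. Qed.

Section Partial.
Variables (R : realType) (V W Y : normedModType R) (f : V * W -> Y) (x : V) (y : W).
Hypothesis df : differentiable f (x, y).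

Lemma differentiable_left : differentiable (fun x' => f (x', y)) x.
Proof. exact: (differentiable_comp (differentiable_pair_cst x y) df). Qed.

Lemma diff_left u : 'd (fun x' => f (x', y)) x u = 'd f (x, y) (u, 0).
Proof.
rewrite -deriveE; last exact: differentiable_left.
rewrite -(deriveE _ df).
suff E : (fun h : R => h^-1 *: (((fun x' => f (x', y)) \o shift x) (h *: u) - f (x, y))) =
    (fun h : R => h^-1 *: ((f \o shift (x, y)) (h *: (u, 0)) - f (x, y))).
  by rewrite /derive E.
apply/funext => h /=; congr (_ *: (f _ - _)).
by rewrite /shift /= -[RHS]/(h *: u + x, h *: 0 + y) scaler0 add0r.
Qed.

Lemma differentiable_right : differentiable (fun y' => f (x, y')) y.
Proof. exact: (differentiable_comp (differentiable_cst_pair x y) df). Qed.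

Lemma diff_right u : 'd (fun y' => f (x, y')) y u = 'd f (x, y) (0, u).
Proof.
rewrite -deriveE; last exact: differentiable_right.
rewrite -(deriveE _ df).
suff E : (fun h : R => h^-1 *: (((fun y' => f (x, y')) \o shift y) (h *: u) - f (x, y))) =
    (fun h : R => h^-1 *: ((f \o shift (x, y)) (h *: (0, u)) - f (x, y))).
  by rewrite /derive E.
apply/funext => h /=; congr (_ *: (f _ - _)).
by rewrite /shift /= -[RHS]/(h *: 0 + x, h *: u + y) scaler0 add0r.
Qed.

End Partial.

(** The momenta [P i] are the fibre derivatives of [l], so the two
    contributions of the acceleration [a], from [w] and from the last argument
    of [l], cancel.  What remains is the Euler-Lagrange expression paired with
    [w], minus the derivative of [l] along the tangent lift of [zeta]. *)
Lemma is_derive_moving_energy (R : realType) n (l : 'rV[R]_n -> 'rV[R]_n -> R)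
    (x : R -> 'rV[R]_n) (zeta : 'rV[R]_n -> 'rV[R]_n) (t : R) :
  let v := derive1 x in
  let w s := v s - zeta (x s) in
  let P i s := 'D_(basis_vec R i) (l (x s)) (v s) in
  differentiable x t -> differentiable v t -> differentiable zeta (x t) ->
  differentiable (fun p => l p.1 p.2) (x t, v t) ->
  (forall i, differentiable (fun p => 'D_(basis_vec R i) (l p.1) p.2) (x t, v t)) ->
  \sum_i w t 0 i * (derive1 (P i) t
     - 'D_(basis_vec R i) (fun y => l y (v t)) (x t)) = 0 ->
  'd (fun p => l p.1 p.2) (x t, v t) (zeta (x t), 'd zeta (x t) (v t)) = 0 ->
  is_derive t 1 (fun s => \sum_i w s 0 i * P i s - l (x s) (v s)) 0.
Proof.
move=> v w P dx dv dz dl dP EL inv.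
set a := derive1 v t.
set l2 := fun p => l p.1 p.2 in dl inv.
have dxv : differentiable (fun s => (x s, v s)) t by apply: differentiable_pair.
have Dxv : 'd (fun s => (x s, v s)) t 1 = (v t, a).
  by rewrite (diff_pair dx dv) /a /v !derive1E' //.
have Dl : is_derive t 1 (fun s => l (x s) (v s)) ('d l2 (x t, v t) (v t, a)).
  have dd := differentiable_comp dxv dl.
  split; first exact: (diff_derivable dd).
  by rewrite (deriveE _ dd) (diff_comp dxv dl) /= Dxv.
have DP i : is_derive t 1 (P i) (derive1 (P i) t).
  have dd := differentiable_comp dxv (dP i).
  by split; [exact: (diff_derivable dd)|rewrite derive1E].
have dzx : differentiable (zeta \o x) t by exact: differentiable_comp.
have dw : differentiable w t by exact: differentiableB.
have Dv : is_derive t 1 v a.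
  by split; [exact: (diff_derivable dv)|rewrite /a derive1E].
have Dzx : is_derive t 1 (zeta \o x) ('d zeta (x t) (v t)).
  split; first exact: (diff_derivable dzx).
  by rewrite (deriveE _ dzx) (diff_comp dx dz) /= -derive1E'.
have Dwt : 'd w t 1 = a - 'd zeta (x t) (v t).
  by rewrite -(deriveE _ dw); exact: (@derive_val _ _ _ _ _ _ _ (is_deriveB Dv Dzx)).
have Dw i : is_derive t 1 (fun s => w s 0 i) ((a - 'd zeta (x t) (v t)) 0 i).
  split; first exact: (diff_derivable (differentiable_entry _ _ dw)).
  by rewrite (derive_coord _ _ _ dw) Dwt.
have DS : is_derive t 1 (fun s => \sum_i w s 0 i * P i s)
   (\sum_i (w t 0 i * derive1 (P i) t + P i t * (a - 'd zeta (x t) (v t)) 0 i)).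
  have -> : (fun s => \sum_i w s 0 i * P i s) = \sum_i (fun s => w s 0 i * P i s).
    by apply/funext => s; rewrite fct_sumE.
  apply: is_derive_sum => i.
  exact: (is_deriveM (Dw i) (DP i)).
have DlE u u' : 'd l2 (x t, v t) (u, u') =
    'd l2 (x t, v t) (u, 0) + 'd l2 (x t, v t) (0, u').
  by rewrite -linearD; congr ('d l2 _ _); rewrite -[RHS]/(u + 0, 0 + u') addr0 add0r.
apply: is_derive_eq (is_deriveB DS Dl) _.
rewrite big_split /=.
have -> : \sum_i P i t * (a - 'd zeta (x t) (v t)) 0 i =
    'd l2 (x t, v t) (0, a - 'd zeta (x t) (v t)).
  rewrite -(diff_right dl) linear_row_sum; apply: eq_bigr => i _; rewrite mulrC; congr (_ * _).
  by rewrite /P (deriveE _ (differentiable_right dl)).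
(* The equations of motion, paired with [w t], trade the derivatives of the
   momenta for the derivatives of [l] in the position. *)
have -> : \sum_i w t 0 i * derive1 (P i) t = 'd l2 (x t, v t) (w t, 0).
  rewrite -(diff_left dl) linear_row_sum.
  apply: subr0_eq; rewrite -sumrB -[RHS]EL; apply: eq_bigr => i _.
  rewrite -mulrBr; congr (_ * (_ - _)).
  by rewrite (deriveE _ (differentiable_left dl)).
rewrite -DlE -linearB -[X in 'd _ _ X]/(w t - v t, a - 'd zeta (x t) (v t) - a) /w.
rewrite addrAC subrr add0r [a - _ - a]addrAC subrr add0r.
by rewrite -[X in 'd _ _ X]/(- (zeta (x t), 'd zeta (x t) (v t))) linearN inv oppr0.
Qed.

(** * Infinitesimal invariance in coordinates *)

(** Here [mu] stands for a local left action in coordinates, with [y0] acting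
    trivially, and [zeta] for its infinitesimal generator in the direction
    [eta].  The invariance identity says that [l] is constant along the curve
    [s |-> (mu, d_x mu v)] at [y = y0 + s *: eta].  The velocity of the second
    component at [s = 0] is a mixed second derivative of [mu]; exchanging the
    order of differentiation makes it the derivative of [zeta] along [v]. *)
Lemma infinitesimal_invariance (R : realType) n (l : 'rV[R]_n -> 'rV[R]_n -> R)
    (mu : 'rV[R]_n * 'rV[R]_n -> 'rV[R]_n) (U : set ('rV[R]_n * 'rV[R]_n))
    (zeta : 'rV[R]_n -> 'rV[R]_n) (y0 x0 eta v : 'rV[R]_n) :
  nbhs (y0, x0) U -> Ck_on 2 U mu ->
  (\forall x \near x0, mu (y0, x) = x) ->
  differentiable zeta x0 ->
  (\forall x \near x0, zeta x = 'd mu (y0, x) (eta, 0)) ->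
  differentiable (fun p => l p.1 p.2) (x0, v) ->
  (\forall s \near (0 : R), l (mu (y0 + s *: eta, x0))
     ('d mu (y0 + s *: eta, x0) (0, v)) = l x0 v) ->
  'd (fun p => l p.1 p.2) (x0, v) (zeta x0, 'd zeta x0 v) = 0.
Proof.
set z0 := (y0, x0); set l2 := fun p => l p.1 p.2.
move=> Uz C2mu mu1 dzeta zetaE dl inv.
have [dmu ddmu] := C2mu.
have Uz0 := nbhs_singleton Uz.
have dmu0 : differentiable mu z0 by exact: dmu.
have ddmu0 w : differentiable (fun p => 'd mu p w) z0.
  by have [h _] := ddmu w; exact: h.
pose Gam p := (mu p, 'd mu p (0, v)).
have dGam : differentiable Gam z0 by apply: differentiable_pair.
have Gam0 : Gam z0 = (x0, v).
  rewrite /Gam (nbhs_singleton mu1); congr pair.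
  rewrite -(diff_right dmu0).
  rewrite (@diff_near_eq _ _ _ _ id x0 v (differentiable_right dmu0) _ mu1).
    by rewrite diff_val.
  exact: ex_diff.
have dl' : differentiable l2 (Gam z0) by rewrite Gam0.
have dlG := differentiable_comp dGam dl'.
have lineE s : z0 + s *: (eta, 0) = (y0 + s *: eta, x0).
  by rewrite -[LHS]/(y0 + s *: eta, x0 + s *: 0) scaler0 addr0.
have z0E : z0 + (0 : R) *: (eta, 0 : 'rV[R]_n) = z0 by rewrite lineE scale0r addr0.
have D : is_derive (0 : R) 1 (fun s => (l2 \o Gam) (z0 + s *: (eta, 0)))
    ('D_(eta, 0) (l2 \o Gam) z0).
  rewrite -[in X in is_derive _ _ _ X]z0E; apply: is_derive_line.
  by rewrite z0E; exact: diff_derivable.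
have D0 : is_derive (0 : R) 1 (fun s => (l2 \o Gam) (z0 + s *: (eta, 0))) 0.
  apply: (@near_eq_is_derive _ _ _ (cst (l x0 v))).
  by apply: filterS inv => s /= <-; rewrite lineE.
have : 'D_(eta, 0) (l2 \o Gam) z0 = 0.
  by rewrite -(@derive_val _ _ _ _ _ _ _ D) (@derive_val _ _ _ _ _ _ _ D0).
have dpart := ddmu0 (eta, 0).
have dG1 : ('d Gam z0 (eta, 0)).1 = zeta x0.
  by rewrite (diff_pair dmu0 (ddmu0 (0, v))) /= (nbhs_singleton zetaE).
have dG2 : ('d Gam z0 (eta, 0)).2 = 'd zeta x0 v.
  rewrite (diff_pair dmu0 (ddmu0 (0, v))) /= (diff_diff_sym _ _ Uz C2mu) -(diff_right dpart).
  apply/esym.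
  exact: (@diff_near_eq _ _ _ zeta _ x0 v dzeta (differentiable_right dpart) zetaE).
move=> <-; rewrite -dG1 -dG2 -surjective_pairing -Gam0.
apply/esym; apply: (etrans (deriveE _ dlG)).
exact: (congr1 (fun f => f (eta, 0)) (diff_comp dGam dl')).
Qed.

(** * Tangent vectors and translations in charts *)

Section Charts.
Variables (R : realType) (n : nat) (G : groupTopType) (S : lie_group R n G).
Implicit Types (c d e : chart R n G) (g h : G).

Lemma chart_im_coord c g : chart_dom c g -> chart_im c (chart_coord c g).
Proof. by move=> cg; exists g. Qed.

Lemma chart_imK c x : chart_im c x ->
  chart_dom c (chart_param c x) /\ chart_coord c (chart_param c x) = x.
Proof. by move=> [g cg <-]; rewrite chart_coordK. Qed.

Lemma nbhs_chart_dom c g : chart_dom c g -> nbhs g (chart_dom c).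
Proof. by move=> cg; apply: open_nbhs_nbhs; split=> //; exact: chart_open_dom. Qed.

Lemma nbhs_chart_im c x : chart_im c x -> nbhs x (chart_im c).
Proof. by move=> cx; apply: open_nbhs_nbhs; split=> //; exact: chart_open_im. Qed.

Lemma near_chart_param c x (A : set G) : chart_im c x -> nbhs (chart_param c x) A ->
  \forall y \near x, A (chart_param c y).
Proof. by move=> cx; exact: (chart_param_cont cx). Qed.

Lemma differentiable_transition c d g : atlas S c -> atlas S d ->
  chart_dom c g -> chart_dom d g ->
  differentiable (chart_coord d \o chart_param c) (chart_coord c g).
Proof.
move=> Sc Sd cg dg; have [h _] := lie_transition Sc Sd 1%N.
by apply: h; exists g.
Qed.

(** The chain rule behind all changes of coordinates.  The derivative on the
    left is directional, so that it makes sense without knowing beforehand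
    that [F] is differentiable in the chart [d]. *)
Lemma derive_chart_change (V : normedModType R) (F : V -> G) c d (z v : V) :
  atlas S c -> atlas S d -> chart_dom c (F z) -> chart_dom d (F z) ->
  {for z, continuous F} -> differentiable (chart_coord c \o F) z ->
  'D_v (chart_coord d \o F) z =
  'd (chart_coord d \o chart_param c) (chart_coord c (F z))
     ('d (chart_coord c \o F) z v).
Proof.
move=> Sc Sd cF dF contF diffF.
have dt := differentiable_transition Sc Sd cF dF.
have E : \forall w \near z, (chart_coord d \o F) w =
    ((chart_coord d \o chart_param c) \o (chart_coord c \o F)) w.
  have N : \forall w \near z, chart_dom c (F w) := contF _ (nbhs_chart_dom cF).
  by apply: filterS N => w /= cw; rewrite chart_coordK.
rewrite (near_eq_derive _ E); apply: (etrans (deriveE _ (differentiable_comp diffF dt))).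
exact: (congr1 (fun f => f v) (diff_comp diffF dt)).
Qed.

Lemma velocity_tvec c (q : R -> G) t : atlas S c -> chart_dom c (q t) ->
  {for t, continuous q} -> differentiable (chart_coord c \o q) t ->
  velocity S q t = tvec S c (chart_coord c (q t)) (derive1 (chart_coord c \o q) t).
Proof.
move=> Sc cq contq dq; rewrite /velocity /tvec derive1E chart_coordK //.
rewrite (derive_chart_change _ Sc (lie_chart_at_atlas S (q t)) cq _ contq dq).
  by rewrite derive1E'.
exact: lie_chart_at_dom.
Qed.

(** The transition maps between [c] and the preferred chart at [g] are inverse
    to each other near [g], hence so are their differentials. *)
Lemma tvec_tcoord c g v : atlas S c -> chart_dom c g ->
  tvec S c (chart_coord c g) (tcoord S c g v) = v.
Proof.
move=> Sc cg; rewrite /tvec /tcoord chart_coordK //.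
set d := chart_at S g.
have Sd : atlas S d := lie_chart_at_atlas S g.
have dg : chart_dom d g := lie_chart_at_dom S g.
have dim := chart_im_coord dg.
have gE := chart_coordK dg.
have := derive_chart_change (F := chart_param d) (z := chart_coord d g) v Sc Sd.
rewrite gE => /(_ cg dg (chart_param_cont dim) (differentiable_transition Sd Sc dg cg)) <-.
have E : \forall w \near chart_coord d g, (chart_coord d \o chart_param d) w = id w.
  by apply: filterS (nbhs_chart_im dim) => w /chart_imK[].
by rewrite (near_eq_derive _ E) derive_id.
Qed.

Definition chart_mul c d e (p : 'rV[R]_n * 'rV[R]_n) : 'rV[R]_n :=
  chart_coord e (chart_param c p.1 * chart_param d p.2)%g.

Definition chart_mul_dom c d e : set ('rV[R]_n * 'rV[R]_n) :=
  [set x | [/\ chart_im c x.1, chart_im d x.2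
             & chart_dom e (chart_param c x.1 * chart_param d x.2)%g]].

Lemma chart_mul_smooth c d e : atlas S c -> atlas S d -> atlas S e ->
  smooth_on (chart_mul_dom c d e) (chart_mul c d e).
Proof. by move=> Sc Sd Se; exact: (lie_mul_smooth Sc Sd Se). Qed.

Lemma differentiable_chart_mul c d e p : atlas S c -> atlas S d -> atlas S e ->
  chart_mul_dom c d e p -> differentiable (chart_mul c d e) p.
Proof. by move=> Sc Sd Se; have [h _] := chart_mul_smooth Sc Sd Se 1%N; exact: h. Qed.

Lemma continuous_chart_param_mul c d x y : chart_im c x -> chart_im d y ->
  {for (x, y), continuous (fun p => (chart_param c p.1 * chart_param d p.2)%g)}.
Proof.
move=> cx dy.
have cc : {for (x, y), continuous (fun p => (chart_param c p.1, chart_param d p.2))}.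
  have c1 : {for (x, y), continuous (chart_param c \o fst)}.
    exact: (@continuous_comp _ _ _ (fst : 'rV[R]_n * 'rV[R]_n -> _) _ (x, y)
      cvg_fst (chart_param_cont cx)).
  have c2 : {for (x, y), continuous (chart_param d \o snd)}.
    exact: (@continuous_comp _ _ _ (snd : 'rV[R]_n * 'rV[R]_n -> _) _ (x, y)
      cvg_snd (chart_param_cont dy)).
  exact: (cvg_pair c1 c2).
exact: (@continuous_comp _ _ _ _ (fun p : G * G => (p.1 * p.2)%g) (x, y) cc
  (@lie_mul_cont _ _ _ S (chart_param c x, chart_param d y))).
Qed.

Lemma nbhs_chart_mul_dom c d e p : chart_mul_dom c d e p ->
  nbhs p (chart_mul_dom c d e).
Proof.
case: p => x y [/= cx dy exy].
have Nx : nbhs (x, y) (fun p => chart_im c p.1) by apply: cvg_fst; exact: nbhs_chart_im.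
have Ny : nbhs (x, y) (fun p => chart_im d p.2) by apply: cvg_snd; exact: nbhs_chart_im.
have Ne := continuous_chart_param_mul cx dy (nbhs_chart_dom exy).
by apply: filterS (filterI Nx (filterI Ny Ne)) => p [? [? ?]].
Qed.

(** At the unit, right translation by [chart_param c x] is the partial map of
    the multiplication in its first argument, so that right invariance writes
    [Z] as a partial derivative of the multiplication. *)
Lemma tcoord_right_invariant c x (Z : G -> 'rV[R]_n) :
  right_invariant_field S Z -> atlas S c -> chart_im c x ->
  let d := chart_at S 1%g in
  tcoord S c (chart_param c x) (Z (chart_param c x)) =
  'd (chart_mul d c c) (chart_coord d 1%g, x) (Z 1%g, 0).
Proof.
move=> Zr Sc cx d.
have [cg gx] := chart_imK cx; set g := chart_param c x in cg *.
have Sd : atlas S d := lie_chart_at_atlas S _.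
have d1 : chart_dom d 1%g := lie_chart_at_dom S _.
have e1 := chart_coordK d1; have dim := chart_im_coord d1.
set e := chart_at S g.
have Se : atlas S e := lie_chart_at_atlas S _.
have eg : chart_dom e g := lie_chart_at_dom S _.
pose F y := (chart_param d y * g)%g.
have F1 : F (chart_coord d 1%g) = g by rewrite /F e1 mul1g.
have contF : {for chart_coord d 1%g, continuous F}.
  have cF : {for chart_coord d 1%g, continuous (fun y => (y, x))}.
    exact: (differentiable_continuous (differentiable_pair_cst _ x)).
  exact: (continuous_comp cF (continuous_chart_param_mul dim cx)).
have dm e' : atlas S e' -> chart_dom e' g ->
    differentiable (chart_mul d c e') (chart_coord d 1%g, x).
  move=> Se' e'g; apply: differentiable_chart_mul => //.
  by split=> //=; rewrite e1 mul1g.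
rewrite -(diff_left (dm c Sc cg)) -(deriveE _ (differentiable_left (dm c Sc cg))).
have := derive_chart_change (F := F) (z := chart_coord d 1%g) (Z 1%g) Se Sc.
rewrite F1 => /(_ eg cg contF (differentiable_left (dm e Se eg))) ->.
rewrite /tcoord; congr ('d _ _ _).
have := Zr g 1%g; rewrite /tmap mul1g => <-.
by [].
Qed.

(** Both sides are the derivative along [v] of the left translate of
    [chart_param c], read in the preferred chart at the product. *)
Lemma tmap_left c d x y v : atlas S c -> atlas S d -> chart_mul_dom d c c (y, x) ->
  tmap S (fun k => chart_param d y * k)%g (chart_param c x) (tvec S c x v) =
  tvec S c (chart_mul d c c (y, x)) ('d (chart_mul d c c) (y, x) (0, v)).
Proof.
move=> Sc Sd Myx; have [/= dy cx chg] := Myx.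
set h := chart_param d y in chg *.
have [cg gx] := chart_imK cx; set g := chart_param c x in cg gx chg *.
set e := chart_at S (h * g)%g.
have Se : atlas S e := lie_chart_at_atlas S _.
have ehg : chart_dom e (h * g)%g := lie_chart_at_dom S _.
set a := chart_at S g.
have Sa : atlas S a := lie_chart_at_atlas S _.
have ag : chart_dom a g := lie_chart_at_dom S _.
have aim := chart_im_coord ag; have aK := chart_coordK ag.
pose F z := (h * chart_param c z)%g.
have contF : {for x, continuous F}.
  have cF : {for x, continuous (fun z => (y, z))}.
    exact: (differentiable_continuous (differentiable_cst_pair y _)).
  exact: (continuous_comp cF (continuous_chart_param_mul dy cx)).
have dc := differentiable_chart_mul Sd Sc Sc Myx.
have tvecE w : tvec S c (chart_coord c (h * g)%g) w =
    'd (chart_coord e \o chart_param c) (chart_coord c (h * g)%g) w.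
  by rewrite /tvec chart_coordK.
have muE : 'd (chart_mul d c c) (y, x) (0, v) = 'd (chart_coord c \o F) x v.
  exact: esym (diff_right dc v).
rewrite muE; apply/esym; apply: (etrans (tvecE _)); apply/esym.
apply: (etrans _ (derive_chart_change (F := F) (z := x) v Sc Se chg ehg contF
  (differentiable_right dc))).
rewrite /tvec /tmap -/g -/a -/e.
have da : differentiable (chart_mul d a e) (y, chart_coord a g).
  by apply: differentiable_chart_mul => //; split=> //=; rewrite aK.
have dt : differentiable (chart_coord a \o chart_param c) x.
  by rewrite -gx; apply: differentiable_transition.
have dr : differentiable (fun z => chart_mul d a e (y, z)) ((chart_coord a \o chart_param c) x).
  exact: (differentiable_right da).
have E : \forall z \near x, (chart_coord e \o F) z =
    ((fun z => chart_mul d a e (y, z)) \o (chart_coord a \o chart_param c)) z.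
  apply: filterS (near_chart_param cx (nbhs_chart_dom ag)) => z /= az.
  by rewrite /chart_mul /= chart_coordK.
rewrite (near_eq_derive _ E); apply/esym.
apply: (etrans (deriveE _ (differentiable_comp dt dr))).
exact: (congr1 (fun f => f v) (diff_comp dt dr)).
Qed.

End Charts.

(** * Natural Lagrangians *)

Section Quadratic.
Variables (R : realType) (n : nat).
Implicit Types (a : 'M[R]_n) (b : 'cV[R]_n) (u v w : 'rV[R]_n).

Lemma metric_formDl a u v w :
  metric_form a (u + v) w = metric_form a u w + metric_form a v w.
Proof. by rewrite /metric_form !mulmxDl mxE. Qed.

Lemma metric_formZl a (k : R) v w : metric_form a (k *: v) w = k * metric_form a v w.
Proof. by rewrite /metric_form -!scalemxAl mxE. Qed.

Lemma metric_formDr a u v w :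
  metric_form a u (v + w) = metric_form a u v + metric_form a u w.
Proof. by rewrite /metric_form linearD mulmxDr mxE. Qed.

Lemma metric_formZr a (k : R) v w : metric_form a v (k *: w) = k * metric_form a v w.
Proof. by rewrite /metric_form linearZ /= -scalemxAr mxE. Qed.

Lemma metric_formC a u v : a^T = a -> metric_form a u v = metric_form a v u.
Proof.
move=> aT; rewrite /metric_form.
have -> : u *m a *m v^T = (v *m a *m u^T)^T by rewrite !trmx_mul trmxK aT mulmxA.
by rewrite mxE.
Qed.

Lemma pairingD b v w : pairing b (v + w) = pairing b v + pairing b w.
Proof. by rewrite /pairing mulmxDl mxE. Qed.

Lemma pairingZ b (k : R) v : pairing b (k *: v) = k * pairing b v.
Proof. by rewrite /pairing -scalemxAl mxE. Qed.

Lemma metric_form_suml a m (f : 'I_m -> 'rV[R]_n) w :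
  metric_form a (\sum_i f i) w = \sum_i metric_form a (f i) w.
Proof. by rewrite /metric_form !mulmx_suml summxE. Qed.

Lemma metric_form_sumr a m (f : 'I_m -> 'rV[R]_n) w :
  metric_form a w (\sum_i f i) = \sum_i metric_form a w (f i).
Proof. by rewrite /metric_form linear_sum mulmx_sumr summxE. Qed.

Lemma pairing_sum b m (f : 'I_m -> 'rV[R]_n) :
  pairing b (\sum_i f i) = \sum_i pairing b (f i).
Proof. by rewrite /pairing mulmx_suml summxE. Qed.

(** Along a line the function is a polynomial of degree two in the parameter,
    whose linear coefficient can be read off. *)
Lemma derive_quadratic a b (k : R) v w : a^T = a ->
  'D_w (fun v => 2^-1 * metric_form a v v + pairing b v - k) v =
  metric_form a v w + pairing b w.
Proof.
move=> aT; set f := fun v => _.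
pose A := metric_form a v w + pairing b w.
pose B := 2^-1 * metric_form a w w.
have D : is_derive (0 : R) 1 (fun h : R => f v + h * A + h * h * B) A.
  apply: is_derive_eq.
  rewrite /GRing.scale /=; ring.
suff E : (fun h : R => h^-1 *: ((f \o shift v) (h *: w) - f v)) =
    (fun h : R => h^-1 *: (((fun h : R => f v + h * A + h * h * B) \o shift 0) (h *: (1 : R))
       - (f v + 0 * A + 0 * 0 * B))).
  by rewrite /derive E; exact: (@derive_val _ _ _ _ _ _ _ D).
apply/funext => h /=; congr (_ *: _); rewrite [h *: 1]mulr1 /shift /= !addr0.
rewrite /f !(metric_formDl, metric_formDr, metric_formZl, metric_formZr, pairingD, pairingZ).
by rewrite (metric_formC w v aT) /A /B; field.
Qed.

End Quadratic.

Lemma differentiable_bigsum (R : realType) (V : normedModType R) m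
    (f : 'I_m -> V -> R) (z : V) :
  (forall i, differentiable (f i) z) -> differentiable (fun p => \sum_i f i p) z.
Proof.
move=> df; have -> : (fun p => \sum_i f i p) = \sum_i f i.
  by apply/funext => p; rewrite fct_sumE.
exact: differentiable_sum.
Qed.

Lemma differentiable_fst (R : realType) (V W : normedModType R) (z : V * W) :
  differentiable (fst : V * W -> V) z.
Proof. by apply: linear_differentiable => p; exact: cvg_fst. Qed.

Lemma differentiable_snd (R : realType) (V W : normedModType R) (z : V * W) :
  differentiable (snd : V * W -> W) z.
Proof. by apply: linear_differentiable => p; exact: cvg_snd. Qed.

Section Natural.
Variables (R : realType) (n : nat) (G : groupTopType) (S : lie_group R n G).
Variables (L : G -> 'rV[R]_n -> R) (a : G -> 'M[R]_n) (b : G -> 'cV[R]_n) (V : G -> R).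
Hypotheses (ha : riemannian_metric S a) (hb : smooth_one_form S b)
  (hV : smooth_function S V)
  (LE : forall g v, L g v = 2^-1 * metric_form (a g) v v + pairing (b g) v - V g).

Lemma momentumE g v w : momentum L g v w = metric_form (a g) v w + pairing (b g) w.
Proof.
have [aT _ _] := ha; rewrite /momentum.
have -> : L g = (fun u => 2^-1 * metric_form (a g) u u + pairing (b g) u - V g).
  by apply/funext => u; exact: LE.
exact: derive_quadratic.
Qed.

Lemma tvec_row_sum c x v :
  tvec S c x v = \sum_i v 0 i *: tvec S c x (basis_vec R i).
Proof.
rewrite /tvec {1}(row_sum_delta v) linear_sum; apply: eq_bigr => i _.
exact: linearZ.
Qed.

Lemma derive_local_lagrangian c x v w :
  'D_w (local_lagrangian S c L x) v =
  momentum L (chart_param c x) (tvec S c x v) (tvec S c x w).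
Proof. exact: (derive_linear_comp ('d _ _) (L (chart_param c x))). Qed.

Variables (c : chart R n G) (x v : 'rV[R]_n).
Hypotheses (Sc : atlas S c) (cx : chart_im c x).

Let A i j y := metric_form (a (chart_param c y))
  (tvec S c y (basis_vec R i)) (tvec S c y (basis_vec R j)).
Let B i y := pairing (b (chart_param c y)) (tvec S c y (basis_vec R i)).

Let dA i j : differentiable (A i j \o fst) (x, v).
Proof.
have [_ _ sm] := ha; have [h _] := sm c Sc (basis_vec R i) (basis_vec R j) 1%N.
exact: (differentiable_comp (differentiable_fst (x, v)) (h _ cx)).
Qed.

Let dB i : differentiable (B i \o fst) (x, v).
Proof.
have [h _] := hb Sc (basis_vec R i) 1%N.
exact: (differentiable_comp (differentiable_fst (x, v)) (h _ cx)).
Qed.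

Let dV : differentiable ((V \o chart_param c) \o fst) (x, v).
Proof.
have [h _] := hV Sc 1%N.
exact: (differentiable_comp (differentiable_fst (x, v)) (h _ cx)).
Qed.

Let dv i : differentiable (fun p : 'rV[R]_n * 'rV[R]_n => p.2 0 i) (x, v).
Proof. exact: (differentiable_entry 0 i (differentiable_snd (x, v))). Qed.

(** In coordinates a natural Lagrangian is a polynomial in the velocities with
    coefficients that are smooth in the position. *)
Lemma differentiable_local_lagrangian :
  differentiable (fun p => local_lagrangian S c L p.1 p.2) (x, v).
Proof.
pose Q (p : 'rV[R]_n * 'rV[R]_n) : R :=
  \sum_i \sum_j p.2 0 i * (p.2 0 j * (A i j \o fst) p).
pose P (p : 'rV[R]_n * 'rV[R]_n) : R := \sum_i p.2 0 i * (B i \o fst) p.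
have -> : (fun p => local_lagrangian S c L p.1 p.2) =
   ((2^-1 : R) *: Q + P) \- ((V \o chart_param c) \o fst).
  apply/funext => -[y w]; rewrite /local_lagrangian LE.
  rewrite (tvec_row_sum c y w) metric_form_suml pairing_sum.
  congr (_ * _ + _ - _).
    apply: eq_bigr => i _; rewrite metric_form_sumr; apply: eq_bigr => j _.
    by rewrite metric_formZl metric_formZr.
  by apply: eq_bigr => i _; rewrite pairingZ.
apply: (differentiableB _ dV); apply: differentiableD.
  apply: differentiableZ; apply: differentiable_bigsum => i.
  apply: differentiable_bigsum => j.
  exact: (differentiableM (dv i) (differentiableM (dv j) (dA i j))).
by apply: differentiable_bigsum => i; exact: (differentiableM (dv i) (dB i)).
Qed.

Lemma differentiable_local_momentum j :
  differentiable (fun p => 'D_(basis_vec R j) (local_lagrangian S c L p.1) p.2) (x, v).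
Proof.
pose P (p : 'rV[R]_n * 'rV[R]_n) : R := \sum_i p.2 0 i * (A i j \o fst) p.
have -> : (fun p => 'D_(basis_vec R j) (local_lagrangian S c L p.1) p.2) =
   P + (B j \o fst).
  apply/funext => -[y w]; rewrite derive_local_lagrangian momentumE.
  rewrite (tvec_row_sum c y w) metric_form_suml; congr (_ + _).
  by apply: eq_bigr => i _; rewrite metric_formZl.
apply: (differentiableD _ (dB j)); apply: differentiable_bigsum => i.
exact: (differentiableM (dv i) (dA i j)).
Qed.

End Natural.

(** * Left-invariant Lagrangians and right-invariant fields *)

Section Invariance.
Variables (R : realType) (n : nat) (G : groupTopType) (S : lie_group R n G).
Variables (c : chart R n G) (Z : G -> 'rV[R]_n).
Hypothesis Sc : atlas S c.

Definition field_coord (x : 'rV[R]_n) : 'rV[R]_n :=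
  tcoord S c (chart_param c x) (Z (chart_param c x)).

Lemma differentiable_field_coord x : smooth_vector_field S Z -> chart_im c x ->
  differentiable field_coord x.
Proof.
move=> hZ [g cg <-]; have [h _] := hZ c Sc 1%N.
by apply: h; exists g.
Qed.

(** [infinitesimal_invariance] for the action of [G] on itself by left
    translations. *)
Lemma left_invariant_symmetry (L : G -> 'rV[R]_n -> R) x v :
  left_invariant_lagrangian S L -> right_invariant_field S Z ->
  chart_im c x -> differentiable field_coord x ->
  differentiable (fun p => local_lagrangian S c L p.1 p.2) (x, v) ->
  'd (fun p => local_lagrangian S c L p.1 p.2) (x, v)
    (field_coord x, 'd field_coord x v) = 0.
Proof.
move=> hL hZ cx dZ dl.
have [cg gx] := chart_imK cx.
set d := chart_at S (1%g : G).
have Sd : atlas S d := lie_chart_at_atlas S _.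
have d1 : chart_dom d 1%g := lie_chart_at_dom S _.
have e1 := chart_coordK d1; have dim := chart_im_coord d1.
have domE : chart_mul_dom d c c (chart_coord d 1%g, x).
  by split=> //=; rewrite e1 mul1g.
have Nx := nbhs_chart_im cx.
apply: (infinitesimal_invariance (l := local_lagrangian S c L)
  (zeta := field_coord) (mu := chart_mul d c c) (eta := Z 1%g)
  (nbhs_chart_mul_dom S domE) (chart_mul_smooth Sd Sc Sc 2%N) _ dZ _ dl).
- by apply: filterS Nx => y /chart_imK[_ yE]; rewrite /chart_mul /= e1 mul1g.
- by apply: filterS Nx => y cy; exact: tcoord_right_invariant.
- pose line (s : R) : 'rV[R]_n := chart_coord d 1%g + s *: Z 1%g.
  have dline : differentiable line (0 : R).
    apply/derivable1_diffP.
    have H := is_derive_line (f := id)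
      (@derivable_id _ _ (chart_coord d 1%g + 0 *: Z 1%g) (Z 1%g)).
    exact: (@ex_derive _ _ _ _ _ _ _ H).
  have dl0 : differentiable (fun s => (line s, x)) (0 : R).
    exact: (differentiable_comp dline (differentiable_pair_cst _ x)).
  have line0 : (line 0, x) = (chart_coord d 1%g, x) by rewrite /line scale0r addr0.
  have N : nbhs (line 0, x) (chart_mul_dom d c c).
    by rewrite line0; exact: (nbhs_chart_mul_dom S domE).
  have contl : {for (0 : R), continuous (fun s => (line s, x))}.
    exact: differentiable_continuous.
  have Nl : \forall s \near (0 : R), chart_mul_dom d c c (line s, x) := contl _ N.
  apply: filterS Nl => s Ms.
  rewrite /local_lagrangian -(tmap_left v Sc Sd Ms).
  have [/= _ _ chg] := Ms.
  by rewrite /chart_mul /= chart_coordK // hL.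
Qed.

End Invariance.

(** * Conservation of the moving energy *)

Section Solution.
Variables (R : realType) (n : nat) (G : groupTopType) (S : lie_group R n G).

(** Regularity that the coordinate computation requires of a solution: the
    velocity in the chart has to be differentiable as well. *)
Lemma smooth_curve_chart (I : set R) (q : R -> G) c t :
  open I -> smooth_curve_on S I q -> atlas S c -> I t -> chart_dom c (q t) ->
  (\forall s \near t, [/\ I s, chart_dom c (q s) & differentiable (chart_coord c \o q) s])
  /\ differentiable (derive1 (chart_coord c \o q)) t.
Proof.
move=> oI [cq sq] Sc It ct; set x := chart_coord c \o q.
have NI : nbhs t I by apply: open_nbhs_nbhs; split.
have Nc : \forall s \near t, chart_dom c (q s) := cq t It _ (nbhs_chart_dom ct).
have [dx ddx] := sq c Sc 2%N.
have N : \forall s \near t, I s /\ chart_dom c (q s) by exact: filterI.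
split.
  by apply: filterS N => s [Is cs]; split=> //; exact: dx.
have [dxt _] := ddx 1.
apply/derivable1_diffP; apply: (near_eq_derivable _ (diff_derivable (dxt t _))) => //.
apply: filterS N => s [Is cs]; rewrite derive1E' //; exact: dx.
Qed.

End Solution.

Section Conservation.
Variables (R : realType) (n : nat) (G : groupTopType) (S : lie_group R n G).
Variables (L : G -> 'rV[R]_n -> R) (D : G -> {vspace 'rV[R]_n}).
Variables (F : G -> 'rV[R]_n -> 'cV[R]_n) (Z : G -> 'rV[R]_n).

(** Linearity of the momentum gathers the two momentum terms into one, paired
    with [v - Z]. *)
Lemma moving_energy_local (a : G -> 'M[R]_n) (b : G -> 'cV[R]_n) (V : G -> R)
    (ha : riemannian_metric S a)
    (LE : forall g v, L g v = 2^-1 * metric_form (a g) v v + pairing (b g) v - V g)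
    c x v : atlas S c -> chart_im c x ->
  moving_energy L Z (chart_param c x) (tvec S c x v) =
  \sum_i (v - field_coord S c Z x) 0 i * 'D_(basis_vec R i) (local_lagrangian S c L x) v
  - local_lagrangian S c L x v.
Proof.
move=> Sc cx; have [cg gx] := chart_imK cx; set g := chart_param c x.
have ZE : Z g = tvec S c x (field_coord S c Z x).
  by have := tvec_tcoord (Z g) Sc cg; rewrite gx => {1}<-.
have momE w : momentum L g (tvec S c x v) (tvec S c x w) =
    \sum_i w 0 i * 'D_(basis_vec R i) (local_lagrangian S c L x) v.
  rewrite (momentumE ha LE) (tvec_row_sum S c x w) metric_form_sumr pairing_sum -big_split /=.
  apply: eq_bigr => i _.
  rewrite derive_local_lagrangian (momentumE ha LE) metric_formZr pairingZ.
  by rewrite mulrDr.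
rewrite /moving_energy /energy ZE !momE addrAC -sumrB; congr (_ - _).
by apply: eq_bigr => i _; rewrite !mxE mulrBl.
Qed.

(** The Euler-Lagrange term is the reaction force paired with
    [velocity - Z], which lies in [D] by the constraint; the other term
    vanishes by [left_invariant_symmetry]. *)
Lemma moving_energy_is_derive0 (M : G -> set 'rV[R]_n) (I : set R) (q : R -> G) t :
  natural_lagrangian S L -> left_invariant_lagrangian S L ->
  smooth_vector_field S Z -> right_invariant_field S Z ->
  (forall g, M g = affine_distribution Z D g) ->
  (forall g v, M g v -> forall w, w \in D g -> pairing (F g v) w = 0) ->
  solution S L M F I q -> I t ->
  is_derive t 1 (fun s => moving_energy L Z (q s) (velocity S q s)) 0.
Proof.
move=> [a [b [V [ha hb hV LE]]]] hLinv hZ hZinv hM hF [[oI itvI] sq qM EL] It.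
set c := chart_at S (q t).
have Sc : atlas S c := lie_chart_at_atlas S _.
have ct : chart_dom c (q t) := lie_chart_at_dom S _.
have cx := chart_im_coord ct.
have [N dv] := smooth_curve_chart oI sq Sc It ct.
set x := chart_coord c \o q in N dv.
have [_ _ dx] := nbhs_singleton N.
have velE s : I s -> chart_dom c (q s) -> differentiable x s ->
    velocity S q s = tvec S c (x s) (derive1 x s).
  by move=> Is cs dxs; apply: velocity_tvec => //; exact: sq.1.
have dz := differentiable_field_coord Sc hZ cx.
have dl := differentiable_local_lagrangian ha hb hV LE (derive1 x t) Sc cx.
have dP := differentiable_local_momentum ha hb LE (derive1 x t) Sc cx.
have [_ xt] := chart_imK cx.
have ELt : \sum_i (derive1 x t - field_coord S c Z (x t)) 0 i *
    (derive1 (fun s => 'D_(basis_vec R i) (local_lagrangian S c L (x s)) (derive1 x s)) t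
     - 'D_(basis_vec R i) (fun y => local_lagrangian S c L y (derive1 x t)) (x t)) = 0.
  have E i := EL t It c Sc ct i.
  rewrite /euler_lagrange /= in E.
  under eq_bigr => i _ do rewrite E -pairingZ.
  rewrite -pairing_sum -tvec_row_sum.
  apply: hF; first exact: qM.
  have ZE : tvec S c (x t) (field_coord S c Z (x t)) = Z (q t).
    rewrite /field_coord /x /= chart_coordK //; exact: tvec_tcoord.
  have -> : tvec S c (x t) (derive1 x t - field_coord S c Z (x t)) =
      velocity S q t - Z (q t).
    by rewrite velE // -ZE /tvec linearB.
  have := qM t It; rewrite hM => -[w Dw <-].
  by rewrite addrAC subrr add0r.
have sym := left_invariant_symmetry Sc hLinv hZinv cx dz dl.
have H := is_derive_moving_energy dx dv dz dl dP ELt sym.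
apply: (near_eq_is_derive _ H).
apply: filterS N => s [Is cs dxs].
rewrite (velE s) // -[in RHS](chart_coordK cs).
by rewrite (moving_energy_local ha LE) //; exact: chart_im_coord.
Qed.

End Conservation.

Theorem proposition12 (R : realType) (n r : nat) (G : groupTopType)
    (S : lie_group R n G)
    (L : G -> 'rV[R]_n -> R) (D : G -> {vspace 'rV[R]_n})
    (M : G -> set 'rV[R]_n) (F : G -> 'rV[R]_n -> 'cV[R]_n)
    (Z : G -> 'rV[R]_n)
    (hr : (1 < r < n)%N)
    (hL : natural_lagrangian S L)
    (hD : smooth_distribution S r D)
    (hDni : ~ integrable_distribution S r D)
    (hZ : smooth_vector_field S Z)
    (hM : forall g, M g = affine_distribution Z D g)
    (hF : reaction_force S L D M F)
    (hLinv : left_invariant_lagrangian S L)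
    (hZinv : right_invariant_field S Z) :
  horizontal_moving_energy S L Z D M (moving_energy L Z) /\
  first_integral S L M F (moving_energy L Z).
Proof.
split.
  exists Z; split=> // g; by rewrite subrr mem0v.
move=> I q sol s t Is It.
have [[_ itvI] _ _ _] := sol; have [hF0 _ _] := hF.
apply: (eq_of_derive0 (f := fun u => moving_energy L Z (q u) (velocity S q u))
  itvI _ Is It) => u Iu.
exact: (moving_energy_is_derive0 hL hLinv hZ hZinv hM hF0 sol Iu).
Qed.
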